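(* Let $\mathscr{A}\subseteq\mathbb{N}$ be an OR$_+$ sequence with $\{0,1\}\subseteq\mathscr{A}$. Suppose that for some integer $h\geq 1$ there are a function $\mathfrak{S}_{\mathscr{A},h}:\mathbb{N}\to[0,+\infty)$ satisfying $$r_{\mathscr{A},h}(n)=\mathfrak{S}_{\mathscr{A},h}(n)J_{\mathscr{A},h}(n)+E(n),\qquad E(n)=o(r_{\mathscr{A},h}(n)),$$ and a real $\varepsilon>0$ such that $$\frac1x\sum_{n\leq x}\mathfrak{S}_{\mathscr{A},h}(n)^{1+\varepsilon}=O(1).$$ Then $\mathscr{A}$ is a stable additive basis.
   Context: $\mathbb{N}$ includes $0$. A sequence $\mathscr{A}=\{a_0<a_1<\cdots\}$ is an infinite subset of $\mathbb{N}$, with counting function $A(x)=|\mathscr{A}\cap[0,x]|$. $\mathscr{A}$ is an OR$_+$ sequence if both $A(2x)=O(A(x))$ and $a_{2n}=O(a_n)$. $r_{\mathscr{A},h}(n)$ is the number of ordered $h$-tuples in $\mathscr{A}^h$ with sum $n$. Define $$J_{\mathscr{A},h}(n)=\int_{\mathbb{R}/\mathbb{Z}}\Big(\sum_{k\leq n}\frac{A(k)}{k+1}e^{2\pi i k\alpha}\Big)^h e^{-2\pi i n\alpha}\,d\alpha=\sum_{\substack{k_1+\cdots+k_h=n\\ k_1,\dots,k_h\geq 0}}\frac{A(k_1)}{k_1+1}\cdots\frac{A(k_h)}{k_h+1}.$$ The condition $E(n)=o(r_{\mathscr{A},h}(n))$ implies $\mathfrak{S}_{\mathscr{A},h}(n)\sim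 r_{\mathscr{A},h}(n)/J_{\mathscr{A},h}(n)$ as $n\to+\infty$ through $h\mathscr{A}=\{k_1+\cdots+k_h:k_i\in\mathscr{A}\}$. A sequence $\mathscr{A}$ is an additive basis if $g\mathscr{A}=\mathbb{N}$ for some integer $g\geq 2$. It is a stable (additive) basis if it is an additive basis and every subsequence $\mathscr{B}\subseteq\mathscr{A}$ with $\{0,1\}\subseteq\mathscr{B}$ and $B(x)=\Theta(A(x))$ is also an additive basis. *)

(* Defs.v *)
From HB Require Import structures.
From mathcomp Require Import all_boot all_order all_algebra.
From mathcomp Require Import finmap.
From mathcomp Require Import all_classical all_reals all_analysis.

Set Implicit Arguments.
Unset Strict Implicit.
Unset Printing Implicit Defensive.

Import Order.TTheory GRing.Theory Num.Theory.
Import numFieldNormedType.Exports.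

Local Open Scope classical_set_scope.
Local Open Scope ring_scope.

(* The notations f =O_+oo g need a canonical filter structure for pinfty_nbhs,
   which the library does not declare. *)
Canonical pinfty_filter_on (R : numFieldType) := FilterType (pinfty_nbhs R) _.

Definition counting_fun (R : realType) (A : set nat) (x : R) : R :=
  #|` fset_set (A `&` [set n | n%:R <= x])|%:R.

(* A is infinite exactly when it has such an enumeration, which is then unique. *)
Definition enumerates (a : nat -> nat) (A : set nat) : Prop :=
  {homo a : m n / (m < n)%N} /\ range a = A.

Definition OR_plus (R : realType) (A : set nat) : Prop :=
  ((fun x : R => counting_fun A (2 * x) : R^o)
     =O_+oo (fun x : R => counting_fun A x : R^o)) /\
  exists2 a : nat -> nat, enumerates a A &
    (fun n => (a (2 * n)%N)%:R : R^o) =O_\oo (fun n => (a n)%:R : R^o).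

(* Nonnegative summands of n are at most n, so the finite type {0, ..., n}^h
   contains every h-tuple with sum n. *)
Definition compositions (h n : nat) : {set {ffun 'I_h -> 'I_n.+1}} :=
  [set k : {ffun 'I_h -> 'I_n.+1} | (\sum_i k i == n)%N]%SET.

Definition repr_count (A : set nat) (h n : nat) : nat :=
  #|[set k in compositions h n | [forall i, (k i : nat) \in A]]%SET|.

(* The n-th Fourier coefficient of the h-th power of
   \sum_(k <= n) A(k)/(k+1) e(k alpha), written out as a finite sum. *)
Definition J (R : realType) (A : set nat) (h n : nat) : R :=
  \sum_(k in compositions h n)
     \prod_i (counting_fun A ((k i)%:R : R) / (k i).+1%:R).

Definition sumset (h : nat) (A : set nat) : set nat :=
  [set n | exists2 k : 'I_h -> nat, (forall i, A (k i)) & n = (\sum_i k i)%N].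

Definition additive_basis (A : set nat) : Prop :=
  exists2 g : nat, (2 <= g)%N & sumset g A = [set: nat].

Definition stable_basis (R : realType) (A : set nat) : Prop :=
  additive_basis A /\
  forall B : set nat,
    infinite_set B -> B `<=` A -> [set 0%N; 1%N] `<=` B ->
    (counting_fun B : R -> R^o) =Theta_+oo (counting_fun A : R -> R^o) ->
    additive_basis B.

(* Main.v *)
Require Import Defs.
From HB Require Import structures.
From mathcomp Require Import all_boot all_order all_algebra.
From mathcomp Require Import finmap.
From mathcomp Require Import all_classical all_reals all_analysis.
From mathcomp Require Import zify ring lra.

Set Implicit Arguments.
Unset Strict Implicit.
Unset Printing Implicit Defensive.

Import Order.TTheory GRing.Theory Num.Theory.
Import numFieldNormedType.Exports.

Local Open Scope classical_set_scope.
Local Open Scope ring_scope.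

(* Write S = hB. The h-tuples of B with entries at most x give
   \sum_(n <= hx) r_B(n) >= B(x)^h >= c^h A(x)^h. Since a_(2n) = O(a_n), A grows
   at least like a power, so the n <= x / D^t contribute little to this sum, and
   \sum_(k <= n) A(k)/(k+1) = O(A(n)), whence J(n) = O(A(n)^h / n). As
   r_A <= 2 SS J for large n, it follows that \sum_(n in S, n <= hx) SS(n) >= c' x;
   truncating SS at a large constant M, the moment hypothesis gives
   |S :&: [1, hx]| >= c'' x. Thus S contains 0 and 1 and has positive
   Schnirelmann density, so by Schnirelmann's theorem finitely many copies of S
   sum to the whole of nat. *)

(** * Schnirelmann density and additive bases *)

Definition pcount (S : pred nat) (n : nat) : nat := (\sum_(1 <= k < n.+1) S k)%N.

Lemma pcount_cat (S : pred nat) (m n : nat) : (m <= n)%N ->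
  pcount S n = (pcount S m + \sum_(m.+1 <= k < n.+1) S k)%N.
Proof. by move=> mn; rewrite /pcount (big_cat_nat (n := m.+1)). Qed.

Lemma pcount_shift_le (S T : pred nat) (a n : nat) : (a <= n)%N ->
  (forall b, T b -> S (a + b)%N) ->
  (pcount T (n - a) <= \sum_(a.+1 <= k < n.+1) S k)%N.
Proof.
move=> an ST; rewrite /pcount -(add1n a) big_addn subSn // leq_sum// => b _.
by rewrite addnC; case Tb : (T b) => //; rewrite ST.
Qed.

(* Induction on n, splitting [1, n] at the largest element a of S below n: the
   translates a + T fill the gap after a with density at least tau. *)
Lemma schnirelmann_ineq (R : realFieldType) (S T U : pred nat) (tau : R) :
  S 0%N -> (forall a b, S a -> T b -> U (a + b)%N) -> T 0%N ->
  (forall n, tau * n%:R <= (pcount T n)%:R) ->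
  forall n, (pcount S n)%:R + tau * (n%:R - (pcount S n)%:R) <= (pcount U n)%:R.
Proof.
move=> S0 STU T0 Ttau; elim/ltn_ind => n IH.
have exa : exists a, S a && (a <= n)%N by exists 0%N; rewrite S0.
have bda a : S a && (a <= n)%N -> (a <= n)%N by case/andP.
case: (ex_maxnP exa bda) => a /andP[Sa an] maxa.
have Stail : (\sum_(a.+1 <= k < n.+1) S k)%N = 0%N.
  rewrite big_nat_cond big1 // => k /andP[/andP[ak kn] _].
  case Sk : (S k) => //; move: (maxa k); rewrite Sk -ltnS kn => /(_ isT).
  by rewrite leqNgt ak.
have Utail : tau * (n - a)%:R <= (\sum_(a.+1 <= k < n.+1) U k)%N%:R.
  apply: le_trans (Ttau _) _; rewrite ler_nat.
  by apply: pcount_shift_le => // b; exact: STU.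
rewrite (pcount_cat _ an) Stail addn0 (pcount_cat U an) natrD.
rewrite natrB // in Utail.
(* If the largest element is 0, the gap is all of [1, n]. Otherwise induction applies just before
   that element, which counts once in [S] and, as 0 is in [T], once in [U]. *)
case: a {exa bda maxa Stail} an Sa Utail => [|a] an Sa Utail.
  by rewrite /pcount !(big_geq (leqnn 1)) // in Utail *; lra.
have /= := IH _ an.
have -> : pcount S a.+1 = (pcount S a).+1.
  by rewrite (pcount_cat S (leqnSn a)) big_nat1 Sa addn1.
have -> : pcount U a.+1 = (pcount U a).+1.
  by rewrite (pcount_cat U (leqnSn a)) big_nat1 -[a.+1]addn0 STU // addn1.
by move: Utail; rewrite -!natr1; lra.
Qed.

(* Pigeonhole on the pairs (a, n - a). *)
Lemma half_density_add (U : pred nat) (n : nat) : U 0%N ->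
  (n <= 2 * pcount U n)%N -> exists2 a, (a <= n)%N & U a && U (n - a)%N.
Proof.
move=> U0 Un; apply/not_exists2P => noa.
have sumU : (\sum_(0 <= a < n.+1) U a)%N = (pcount U n).+1.
  by rewrite big_nat_recl // U0 add1n /pcount big_add1.
have : (\sum_(0 <= a < n.+1) (U a + U (n - a)) <= \sum_(0 <= a < n.+1) 1)%N.
  rewrite big_nat_cond [leqRHS]big_nat_cond leq_sum // => a /andP[/andP[_ an] _].
  case: (noa a) => [|/negP]; first by rewrite -ltnS an.
  by case: (U a); case: (U _).
rewrite sum_nat_const_nat muln1 subn0 big_split /=.
have -> : (\sum_(0 <= a < n.+1) U (n - a) = \sum_(0 <= a < n.+1) U a)%N.
  rewrite big_nat_rev /=; apply: eq_big_nat => a /andP[_ an].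
  by rewrite add0n subSS subKn.
by rewrite sumU; lia.
Qed.

Lemma sumset_add (B : set nat) (g g' : nat) (m n : nat) :
  sumset g B m -> sumset g' B n -> sumset (g + g') B (m + n)%N.
Proof.
move=> [k kB ->] [l lB ->].
exists (fun i : 'I_(g + g') =>
  match fintype.split i with inl j => k j | inr j => l j end).
  by move=> i; case: (fintype.split i).
rewrite big_split_ord; congr (_ + _)%N; apply: eq_bigr => i _.
  by case: split_ordP => j /eqP; rewrite ?eq_lshift ?eq_lrshift // => /eqP->.
by case: split_ordP => j /eqP; rewrite ?eq_rshift ?eq_rlshift // => /eqP->.
Qed.

Lemma sumset0n (B : set nat) (g : nat) : B 0%N -> sumset g B 0%N.
Proof. by move=> B0; exists (fun=> 0%N) => //; rewrite big1. Qed.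

Lemma sumset_mem (B : set nat) (g n : nat) : (1 <= g)%N -> B 0%N -> B n ->
  sumset g B n.
Proof.
case: g => // g _ B0 Bn; rewrite -[n]addn0 -add1n; apply: sumset_add.
  by exists (fun=> n) => //; rewrite big_ord1.
exact: sumset0n.
Qed.

(** By [schnirelmann_ineq], each further summand gB multiplies the missing density by at most 1 -
    tau, so kgB has density at least 1 - (1 - tau)^k. Once this reaches 1/2, [half_density_add]
    makes 2kgB everything. *)
Lemma additive_basis_density (R : realType) (B : set nat) (g : nat) (tau : R) :
  (1 <= g)%N -> B 0%N -> 0 < tau ->
  (forall n, tau * n%:R <= (pcount (mem (sumset g B)) n)%:R) ->
  additive_basis B.
Proof.
move=> g1 B0 tau0 dens.
have tau1 : tau <= 1.
  have := dens 1%N; rewrite /pcount big_nat1 mulr1 => /le_trans; apply.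
  by rewrite lern1 leq_b1.
have densk k : forall n, (1 - (1 - tau) ^+ k) * n%:R <=
    (pcount (mem (sumset (k * g) B)) n)%:R.
  elim: k => [|k IH] n; first by rewrite expr0 subrr mul0r.
  have H := @schnirelmann_ineq R (mem (sumset (k * g) B)) (mem (sumset g B))
    (mem (sumset (k.+1 * g) B)) tau.
  have {}H : (pcount (mem (sumset (k * g) B)) n)%:R
      + tau * (n%:R - (pcount (mem (sumset (k * g) B)) n)%:R)
      <= (pcount (mem (sumset (k.+1 * g) B)) n)%:R :> R.
    apply: H => //.
    - by apply/mem_set/sumset0n.
    - move=> a b /set_mem Sa /set_mem Sb; apply/mem_set.
      by rewrite mulSnr; apply: sumset_add.
    - by apply/mem_set/sumset0n.
  apply: le_trans H; have := IH n; set p := (pcount _ _)%:R => pn.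
  have : (1 - tau) * ((1 - (1 - tau) ^+ k) * n%:R) <= (1 - tau) * p.
    by rewrite ler_wpM2l // subr_ge0.
  by rewrite exprS; lra.
have [k [k1 kle]] : exists k, (1 <= k)%N /\ (1 - tau) ^+ k <= 1 / 2.
  have : (1 - tau) ^+ n @[n --> \oo] --> (0 : R).
    by apply: cvg_expr; rewrite ger0_norm; lra.
  move=> /cvgrPdist_le /(_ (1/2)) [//|N _ HN].
  exists N.+1; split => //; have := HN N.+1 (leqnSn N).
  by rewrite sub0r normrN => /(le_trans (ler_norm _)).
exists (k * g + k * g)%N; first by move: k1 g1; case: k {kle}; case: (g); lia.
apply/seteqP; split=> // n _.
have [//||a an /andP[/set_mem Sa /set_mem Sb]] :=
  @half_density_add (mem (sumset (k * g) B)) n.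
- by apply/mem_set/sumset0n.
- have := densk k n; set p := pcount _ _.
  rewrite -(@ler_nat R) natrM => H.
  apply: le_trans (_ : 2 * ((1 - (1 - tau) ^+ k) * n%:R) <= _).
    have := ler0n R n; nra.
  by rewrite ler_wpM2l.
by rewrite -(subnKC an); apply: sumset_add.
Qed.

(** * Convolution powers and sums over compositions *)

(** The coefficient of X^n in the h-th power of the series with coefficients [f]. The recursive form
    lets both r and J be estimated by induction on h. *)
Fixpoint conv (R : pzSemiRingType) (f : nat -> R) (h n : nat) : R :=
  if h is h'.+1 then \sum_(0 <= j < n.+1) f j * conv f h' (n - j)
  else (n == 0%N)%:R.

Lemma coef_poly_exp (R : comNzRingType) (f : nat -> R) (N h n : nat) :
  (n <= N)%N -> ((\poly_(k < N.+1) f k) ^+ h)`_n = conv f h n.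
Proof.
elim: h n => [|h IH] n nN /=; first by rewrite expr0 coef1.
rewrite exprS coefM big_mkord; apply: eq_bigr => i _.
have iN : (i <= N)%N by rewrite (leq_trans _ nN) // -ltnS.
by rewrite coef_poly ltnS iN IH // (leq_trans (leq_subr _ _)).
Qed.

(** Distributivity expands the h-th power of the polynomial truncated at degree n into monomials
    indexed by h-tuples; compositions of n are those contributing to X^n. *)
Lemma sum_compositions (R : comNzRingType) (f : nat -> R) (h n : nat) :
  \sum_(k in compositions h n) \prod_i f (k i) = conv f h n.
Proof.
rewrite -(coef_poly_exp f h (leqnn n)) poly_def.
rewrite -[h in _ ^+ h]card_ord -prodr_const bigA_distr_bigA coef_sum big_mkcond /=.
apply: eq_bigr => k _; rewrite inE.
rewrite scaler_prod coefZ prodrXr coefXn eq_sym.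
by case: eqP; rewrite ?mulr1 ?mulr0.
Qed.

Lemma repr_countE (R : comNzRingType) (A : set nat) (h n : nat) :
  (repr_count A h n)%:R = conv (fun k => (k \in A)%:R : R) h n.
Proof.
rewrite -sum_compositions /repr_count -sum1_card natr_sum big_mkcond /=.
rewrite [RHS]big_mkcond /=; apply: eq_bigr => k _; rewrite inE.
case: (k \in _) => //=; case: forallP => [kA|nkA].
  by rewrite big1 // => i _; rewrite kA.
have /existsP[i /negPf iA] : [exists i, (k i : nat) \notin A].
  by rewrite -negb_forall; apply/negP => /forallP.
by rewrite (bigD1 i) //= iA mul0r.
Qed.

Lemma repr_count_sumset (A : set nat) (h n : nat) :
  repr_count A h n != 0%N -> sumset h A n.
Proof.
rewrite -lt0n => /card_gt0P[k]; rewrite !inE => /andP[/eqP kn /forallP kA].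
by exists (fun i => nat_of_ord (k i)) => [i|]; [apply/set_mem | rewrite kn].
Qed.

(** * Bounds for convolution powers *)

Lemma sum_triangle (R : pzSemiRingType) (f g : nat -> R) (m : nat) :
  \sum_(0 <= n < m.+1) \sum_(0 <= j < n.+1) f j * g (n - j)%N =
  \sum_(0 <= j < m.+1) f j * \sum_(0 <= i < (m - j).+1) g i.
Proof.
elim: m => [|m IH]; first by rewrite !big_nat1.
rewrite big_nat_recr //= IH [in RHS]big_nat_recr //= subnn big_nat1.
rewrite [X in _ + X]big_nat_recr //= subnn addrA -big_split /=.
congr (_ + _); apply: eq_big_nat => j /andP[_ jm].
by rewrite subSn // [in RHS]big_nat_recr //= mulrDr.
Qed.

Section ConvBounds.
Context {R : realFieldType}.
Implicit Types f : nat -> R.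

Lemma ler_sum_range f (m n : nat) : (forall k, 0 <= f k) -> (m <= n)%N ->
  \sum_(0 <= k < m) f k <= \sum_(0 <= k < n) f k.
Proof.
by move=> f0 mn; rewrite (big_cat_nat _ mn) //= lerDl sumr_ge0.
Qed.

Lemma conv_ge0 f (h n : nat) : (forall k, 0 <= f k) -> 0 <= conv f h n.
Proof.
by move=> f0; elim: h n => [|h IH] n //=; rewrite sumr_ge0 // => j _; rewrite mulr_ge0.
Qed.

(** Tuples with sum at most m lie in the box [0, m]^h. *)
Lemma sum_conv_le f (h m : nat) : (forall k, 0 <= f k) ->
  \sum_(0 <= n < m.+1) conv f h n <= (\sum_(0 <= k < m.+1) f k) ^+ h.
Proof.
move=> f0; elim: h m => [|h IH] m /=.
  by rewrite big_nat_recl // eqxx big1 // addr0 expr0.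
rewrite sum_triangle exprS mulr_suml ler_sum_nat // => j /andP[_ jm].
rewrite ler_wpM2l //; apply: le_trans (IH _) _.
rewrite lerXn2r ?nnegrE ?sumr_ge0 //.
by apply: ler_sum_range => //; rewrite ltnS leq_subr.
Qed.

(** Tuples in the box [0, m]^h have sum at most hm. *)
Lemma sum_conv_ge f (h m : nat) : (forall k, 0 <= f k) ->
  (\sum_(0 <= k < m.+1) f k) ^+ h <= \sum_(0 <= n < (h * m).+1) conv f h n.
Proof.
move=> f0; elim: h => [|h IH] /=; first by rewrite mul0n big_nat1 expr0.
rewrite sum_triangle exprS.
apply: (@le_trans _ _ (\sum_(0 <= j < m.+1) f j *
    \sum_(0 <= i < (h.+1 * m - j).+1) conv f h i)).
  rewrite mulr_suml ler_sum_nat // => j /andP[_ jm].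
  rewrite ler_wpM2l //; apply: le_trans IH _.
  by apply: ler_sum_range; [move=> k; exact: conv_ge0 | rewrite mulSn; lia].
apply: ler_sum_range => [j|]; last by rewrite mulSn; lia.
by rewrite mulr_ge0 // sumr_ge0 // => i _; exact: conv_ge0.
Qed.

(* Distributing the factor n = k_1 + ... + k_h over a composition of n replaces
   one of the weights f(k_i) by k_i f(k_i). *)
Lemma conv_le f (K : R) (N h n : nat) : (forall k, 0 <= f k) -> 0 <= K ->
  (n <= N)%N ->
  \sum_(0 <= k < N.+1) f k <= K ->
  (forall k, (k <= N)%N -> k%:R * f k <= K) ->
  n%:R * conv f h n <= h%:R * K ^+ h.
Proof.
move=> f0 K0 nN sumK fK; elim: h n nN => [|h IH] n nN /=.
  by case: n nN => [|n] nN; rewrite ?mul0r ?mulr0.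
have le1 : \sum_(0 <= j < n.+1) conv f h j <= K ^+ h.
  apply: le_trans (sum_conv_le _ _ f0) _.
  rewrite lerXn2r ?nnegrE ?sumr_ge0 //; apply: le_trans sumK.
  exact: ler_sum_range.
have le2 : \sum_(0 <= j < n.+1) f j <= K.
  by apply: le_trans sumK; exact: ler_sum_range.
(* Writing n = j + (n - j), the first part uses the pointwise bound on j f(j), the second the
   induction hypothesis. *)
have -> : n%:R * \sum_(0 <= j < n.+1) f j * conv f h (n - j)%N =
  \sum_(0 <= j < n.+1) (j%:R * f j) * conv f h (n - j)%N +
  \sum_(0 <= j < n.+1) f j * ((n - j)%:R * conv f h (n - j)%N).
  rewrite -big_split mulr_sumr; apply: eq_big_nat => j /andP[_ jn] /=.
  by rewrite natrB; [ring | lia].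
have s1 : \sum_(0 <= j < n.+1) (j%:R * f j) * conv f h (n - j)%N <= K * K ^+ h.
  apply: le_trans (_ : K * \sum_(0 <= j < n.+1) conv f h j <= _); last first.
    by rewrite ler_wpM2l.
  rewrite [X in _ <= K * X]big_nat_rev /= mulr_sumr ler_sum_nat // => j jn.
  rewrite add0n subSS ler_wpM2r ?conv_ge0 // fK //; lia.
have s2 : \sum_(0 <= j < n.+1) f j * ((n - j)%:R * conv f h (n - j)%N)
    <= K * (h%:R * K ^+ h).
  apply: le_trans (_ : (\sum_(0 <= j < n.+1) f j) * (h%:R * K ^+ h) <= _).
    rewrite mulr_suml ler_sum_nat // => j jn; rewrite ler_wpM2l // IH //; lia.
  by rewrite ler_wpM2r // mulr_ge0 // exprn_ge0.
rewrite -natr1 exprS; lra.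
Qed.

End ConvBounds.

(** * The counting function at integers *)

Lemma sum_bool_count (T : Type) (r : seq T) (P : pred T) :
  (\sum_(i <- r) P i)%N = count P r.
Proof.
by rewrite -sum1_count [RHS]big_mkcond; apply: eq_bigr => i _; case: (P i).
Qed.

Definition ncount (A : set nat) (n : nat) : nat :=
  (\sum_(0 <= k < n.+1) (k \in A))%N.

Lemma counting_funE (R : realType) (A : set nat) (n : nat) :
  counting_fun A (n%:R : R) = (ncount A n)%:R.
Proof.
rewrite /counting_fun /ncount sum_bool_count -size_filter.
set s := [seq k <- _ | _].
have mem_s k : (k \in s) = (k \in A) && (k <= n)%N.
  by rewrite mem_filter mem_index_iota ltnS.
have -> : A `&` [set k | k%:R <= n%:R :> R] = [set` s].
  apply/seteqP; split=> k; rewrite /= mem_s ler_nat.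
    by case=> Ak ->; rewrite andbT; apply/mem_set.
  by move=> /andP[/set_mem Ak ->].
congr _%:R; apply: perm_size; apply: uniq_perm; rewrite ?fset_uniq ?filter_uniq ?iota_uniq //.
by move=> k; rewrite in_fset_set; [apply: (asboolb (k \in s)) | exact: finite_seq].
Qed.

Lemma leq_ncount (A : set nat) (m n : nat) : (m <= n)%N ->
  (ncount A m <= ncount A n)%N.
Proof. by move=> mn; rewrite /ncount [leqRHS](big_cat_nat (n := m.+1)) //= leq_addr. Qed.

Lemma ncount_gt0 (A : set nat) (n : nat) : A 0%N -> (0 < ncount A n)%N.
Proof.
by move=> A0; apply: leq_trans (leq_ncount A (leq0n n)); rewrite /ncount big_nat1 mem_set.
Qed.

(** Enumeration and counting function are inverse to each other in this sense, which turns a bound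
    on a_(2n) into growth of A. *)
Lemma ltn_ncount (a : nat -> nat) (A : set nat) (i m : nat) : enumerates a A ->
  (i < ncount A m)%N = (a i <= m)%N.
Proof.
move=> [homa rga].
have mona : {mono a : i j / (i <= j)%N} by apply: leq_mono.
have lea j : (j <= a j)%N.
  by elim: j => // j IH; apply: leq_ltn_trans IH (homa _ _ (ltnSn j)).
(* Elements are counted by index instead; since j <= a_j, the indices up to m suffice. *)
have -> : ncount A m = (\sum_(0 <= j < m.+1) (a j <= m))%N.
  rewrite /ncount !sum_bool_count -!size_filter.
  set s := [seq k <- _ | _]; set t := [seq j <- _ | _].
  have uniq_s : uniq s by rewrite filter_uniq ?iota_uniq.
  have uniq_t : uniq t by rewrite filter_uniq ?iota_uniq.
  rewrite -(size_map a t); apply: perm_size; apply: uniq_perm => //.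
    rewrite map_inj_uniq // => x y axy.
    by apply/eqP; rewrite eqn_leq -(mona x) -(mona y) axy leqnn.
  move=> k; rewrite mem_filter mem_index_iota ltnS; apply/andP/mapP.
    move=> [/set_mem]; rewrite -rga => -[j _ <-] ajm; exists j => //.
    by rewrite mem_filter mem_index_iota ltnS (leq_trans (lea j)) ?andbT.
  move=> [j]; rewrite mem_filter => /andP[ajm _] ->; split=> //.
  by rewrite -rga; apply/mem_set; exists j.
case: (leqP (a i) m) => [aim|mai].
  have im : (i <= m)%N := leq_trans (lea i) aim.
  rewrite (big_cat_nat (n := i.+1)) //=; apply: ltn_addr.
  rewrite (eq_big_nat _ _ (F2 := fun=> 1%N)) ?sum_nat_const_nat ?muln1 ?subn0 //.
  by move=> j; rewrite ltnS /= => ji; rewrite (leq_trans _ aim) // mona.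
apply/negbTE; rewrite -leqNgt.
apply: leq_trans (_ : \sum_(0 <= j < m.+1) (j < i) <= _)%N.
  apply: leq_sum => j _; case: (leqP (a j) m) => // ajm.
  suff -> : (j < i)%N by [].
  by rewrite ltnNge -mona -ltnNge (leq_ltn_trans ajm).
rewrite sum_bool_count -size_filter.
apply: leq_trans (_ : size (index_iota 0 i) <= i)%N; last by rewrite size_iota subn0.
apply: uniq_leq_size; first by rewrite filter_uniq ?iota_uniq.
by move=> j; rewrite mem_filter !mem_index_iota leq0n => /andP[].
Qed.

(** * Growth of the counting function *)

Lemma pinfty_nat (R : realType) (P : R -> Prop) :
  (\forall x \near +oo, P x) -> exists N : nat, forall n, (N <= n)%N -> P n%:R.
Proof.
move=> [M [_ HM]]; exists (Num.truncn M).+1 => n Mn; apply: HM.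
by rewrite (lt_le_trans (truncnS_gt M)) // ler_nat.
Qed.

Lemma eqO_pinfty_nat (R : realType) (u v : R -> R^o) : u =O_+oo v ->
  exists2 K : R, 0 < K & exists N : nat, forall n, (N <= n)%N ->
    `|u n%:R| <= K * `|v n%:R|.
Proof. by move=> /eqO_exP[K K0 /pinfty_nat]; exists K. Qed.

Lemma eqO_nat (R : realType) (u v : nat -> R^o) : u =O_\oo v ->
  exists2 K : R, 0 < K & exists N : nat, forall n, (N <= n)%N ->
    `|u n| <= K * `|v n|.
Proof. by move=> /eqO_exP[K K0 [N _ HN]]; exists K => //; exists N. Qed.

Lemma leq_ncountS (A : set nat) (n : nat) : (ncount A n <= n.+1)%N.
Proof.
rewrite /ncount sum_bool_count; apply: leq_trans (count_size _ _) _.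
by rewrite size_iota.
Qed.

(** For n below the threshold N, A(2n) <= 2N + 1 while A(n) >= 1, so adding 2N + 1 to the constant
    makes the bound hold for every n. *)
Lemma ncount_doubling (R : realType) (A : set nat) : A 0%N ->
  (fun x : R => counting_fun A (2 * x) : R^o)
    =O_+oo (fun x : R => counting_fun A x : R^o) ->
  exists2 C : R, 1 <= C &
    forall n, (ncount A (2 * n))%:R <= C * (ncount A n)%:R.
Proof.
move=> A0 /eqO_pinfty_nat[K K0 [N HN]].
exists (K + (2 * N).+1%:R) => [|n].
  by apply: ler_wpDl; [exact: ltW | rewrite ler1n].
have n0 : 1 <= (ncount A n)%:R :> R by rewrite ler1n ncount_gt0.
rewrite mulrDl; case: (leqP N n) => [/HN|nN].
  rewrite -natrM !counting_funE !normr_nat => /le_trans; apply.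
  by rewrite lerDl mulr_ge0.
apply: le_trans (_ : (2 * N).+1%:R * (ncount A n)%:R <= _); last first.
  by rewrite lerDr mulr_ge0 // ltW.
apply: le_trans (_ : (2 * N).+1%:R <= _); last by rewrite ler_peMr.
by rewrite ler_nat (leq_trans (leq_ncountS _ _)) // ltnS leq_mul2l ltnW.
Qed.

(** Since h <= 2^h, h doublings suffice. *)
Lemma ncount_dilate (R : realType) (A : set nat) (h : nat) : A 0%N ->
  (fun x : R => counting_fun A (2 * x) : R^o)
    =O_+oo (fun x : R => counting_fun A x : R^o) ->
  exists2 C : R, 1 <= C &
    forall n, (ncount A (h * n))%:R <= C * (ncount A n)%:R.
Proof.
move=> A0 /(ncount_doubling A0)[C C1 HC].
have C0 : 0 <= C by lra.
have pow j n : (ncount A (2 ^ j * n))%:R <= C ^+ j * (ncount A n)%:R.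
  elim: j => [|j IH]; first by rewrite expn0 mul1n expr0 mul1r.
  rewrite expnS -mulnA (le_trans (HC _)) // exprS -mulrA ler_wpM2l //.
exists (C ^+ h) => [|n]; first exact: exprn_ege1.
apply: le_trans (pow h n); rewrite ler_nat leq_ncount // leq_mul2r.
by rewrite (ltnW (ltn_expl _ _)) ?orbT.
Qed.

(** With i = A(m) - 1, a_i <= m gives a_(2i) <= D m, hence A(Dm) >= 2 A(m) - 1. This is at least
    (3/2) A(m) because 0 and 1 give A(m) >= 2. *)
Lemma ncount_growth (R : realType) (A : set nat) (a : nat -> nat) :
  [set 0%N; 1%N] `<=` A -> enumerates a A ->
  (fun n => (a (2 * n)%N)%:R : R^o) =O_\oo (fun n => (a n)%:R : R^o) ->
  exists2 D, (2 <= D)%N &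
    forall m, (1 <= m)%N -> (3 * ncount A m <= 2 * ncount A (D * m))%N.
Proof.
move=> A01 aA /eqO_nat[K K0 [N HN]].
have mona i j : (i <= j)%N -> (a i <= a j)%N.
  by case: aA => homa _ ij; rewrite (leq_mono homa).
have a0 : a 0%N = 0%N.
  apply/eqP; rewrite -leqn0 -(ltn_ncount 0 0 aA); apply: ncount_gt0.
  by apply: A01; left.
have a_gt0 n : (0 < n)%N -> (0 < a n)%N.
  by case: aA => homa _ n0; rewrite -{1}a0 homa.
(* The first summand serves n >= N; the second serves 0 < n < N, where a_n >= 1. *)
pose D := ((Num.truncn K).+1 + a (2 * N)).+1.
have aD n : (a (2 * n) <= D * a n)%N.
  case: (posnP n) => [->|n0]; first by rewrite a0.
  case: (leqP N n) => [/HN|nN].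
    rewrite !normr_nat -(ler_nat R) => /le_trans; apply.
    rewrite natrM ler_wpM2r // (le_trans (ltW (truncnS_gt K))) //.
    by rewrite ler_nat leqW ?leq_addr.
  apply: (@leq_trans (a (2 * N)%N)); first by rewrite mona // leq_mul2l ltnW.
  apply: leq_trans (_ : D * 1 <= _)%N; last by rewrite leq_mul2l a_gt0.
  by rewrite muln1 leqW // leq_addl.
exists D => [|m m1]; first by rewrite /D; lia.
have c2 : (2 <= ncount A m)%N.
  apply: leq_trans (leq_ncount A m1).
  have Ai i : (i < 2)%N -> i \in A.
    by move=> i2; apply/mem_set/A01; case: i i2 => [|[|]] //; [left | right].
  by rewrite /ncount big_nat_recr //= big_nat1 !Ai.
have := ltn_ncount (ncount A m).-1 m aA; rewrite prednK; last by lia.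
rewrite leqnn => /esym am.
suff : (2 * (ncount A m).-1 < ncount A (D * m))%N by lia.
by rewrite (ltn_ncount _ _ aA) (leq_trans (aD _)) // leq_mul2l am orbT.
Qed.

Lemma ncount_growth_iter (R : realFieldType) (A : set nat) (D : nat) :
  (1 <= D)%N ->
  (forall m, (1 <= m)%N -> (3 * ncount A m <= 2 * ncount A (D * m))%N) ->
  forall t m, (1 <= m)%N ->
    (ncount A m)%:R <= (2 / 3) ^+ t * (ncount A (D ^ t * m))%:R :> R.
Proof.
move=> D1 HD; elim=> [|t IH] m m1; first by rewrite expr0 mul1r expn0 mul1n.
have /IH : (1 <= D * m)%N by rewrite muln_gt0 D1.
rewrite mulnA -expnSr exprS; set p := _ ^+ t; set x := (ncount A (_ ^ _ * _))%:R.
by have := HD m m1; rewrite -(ler_nat R) !natrM; lra.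
Qed.

(** * The bound for J, and the comparison of B with A *)

(** Strong induction, cutting at m = n / D. Fewer than D (m + 1) terms lie beyond m, each at most
    A(n) / (m + 1), for a total of D A(n); the head is at most 3 D A(m) <= 2 D A(n) by the growth
    hypothesis. *)
Lemma sum_density_le (R : realType) (A : set nat) (D : nat) : A 0%N ->
  (2 <= D)%N ->
  (forall m, (1 <= m)%N -> (3 * ncount A m <= 2 * ncount A (D * m))%N) ->
  forall n, \sum_(0 <= k < n.+1) (ncount A k)%:R / k.+1%:R
     <= 3 * D%:R * (ncount A n)%:R :> R.
Proof.
move=> A0 D2 HD; elim/ltn_ind => n IH.
have D2R : 2 <= D%:R :> R by rewrite ler_nat.
case: (posnP n) => [->|n0].
  rewrite big_nat1 divr1.
  have : 1 <= (ncount A 0)%:R :> R by rewrite ler1n ncount_gt0.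
  by move: (_%:R : R) => c; nra.
pose m := (n %/ D)%N.
have mn : (m < n)%N by rewrite ltn_Pdiv.
have nD : (n < D * m.+1)%N by rewrite mulnC ltn_ceil //; lia.
rewrite (big_cat_nat (n := m.+1)) //=; last by rewrite ltnS ltnW.
have tail : \sum_(m.+1 <= k < n.+1) (ncount A k)%:R / k.+1%:R
    <= D%:R * (ncount A n)%:R :> R.
  apply: le_trans (_ : \sum_(m.+1 <= k < n.+1) (ncount A n)%:R / m.+1%:R <= _).
    apply: ler_sum_nat => k /andP[mk kn]; apply: ler_pM => //.
      by rewrite ler_nat leq_ncount.
    by rewrite lef_pV2 ?posrE ?ltr0n // ler_nat; lia.
  rewrite sumr_const_nat -[_ *+ (_ - _)]mulr_natl mulrCA [leRHS]mulrC ler_wpM2l //.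
  rewrite ler_pdivrMr ?ltr0n // -natrM ler_nat; lia.
have main : (\sum_(0 <= k < m.+1) (ncount A k)%:R / k.+1%:R : R)
    <= 2 * D%:R * (ncount A n)%:R.
  case: (posnP m) => [->|m0].
    rewrite big_nat1 divr1.
    have : (ncount A 0)%:R <= (ncount A n)%:R :> R by rewrite ler_nat leq_ncount.
    by have := ler0n R (ncount A 0); nra.
  apply: le_trans (IH _ mn) _.
  have : 3 * (ncount A m)%:R <= 2 * (ncount A n)%:R :> R.
    rewrite -!natrM ler_nat (leq_trans (HD _ m0)) // leq_mul2l leq_ncount //.
    by rewrite mulnC leq_trunc_div.
  by nra.
lra.
Qed.

Lemma ncount_Theta (R : realType) (A B : set nat) : B 0%N ->
  (counting_fun B : R -> R^o) =Theta_+oo (counting_fun A : R -> R^o) ->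
  exists2 c : R, 0 < c & forall n, c * (ncount A n)%:R <= (ncount B n)%:R.
Proof.
move=> B0; rewrite eqThetaE qualifE => /asboolP[[k k'] /andP[/= k0 _]] /pinfty_nat[N HN].
(* The denominator absorbs the n below the threshold, where A(n) <= N + 1 and B(n) >= 1. *)
exists (k / (1 + k * N.+1%:R)) => [|n].
  by rewrite divr_gt0 // ltr_wpDr // mulr_ge0 // ltW.
have d0 : 0 < 1 + k * N.+1%:R by rewrite ltr_wpDr // mulr_ge0 // ltW.
have B1 : 1 <= (ncount B n)%:R :> R by rewrite ler1n ncount_gt0.
rewrite mulrAC ler_pdivrMr //.
have kN : 0 <= k * N.+1%:R by rewrite mulr_ge0 // ltW.
case: (leqP N n) => [/HN[]|nN].
  by rewrite !counting_funE !normr_nat; nra.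
have : k * (ncount A n)%:R <= k * N.+1%:R.
  rewrite ler_pM2l // ler_nat (leq_trans (leq_ncountS _ _)) //.
  by rewrite ltnW // ltnS.
nra.
Qed.

(** This is [conv_le] for f(k) = A(k) / (k + 1) and K = 3 D A(N), as k f(k) <= A(k) <= A(N). *)
Lemma J_le (R : realType) (A : set nat) (D h n N : nat) : A 0%N ->
  (2 <= D)%N ->
  (forall m, (1 <= m)%N -> (3 * ncount A m <= 2 * ncount A (D * m))%N) ->
  (n <= N)%N ->
  n%:R * J R A h n <= h%:R * (3 * D%:R * (ncount A N)%:R) ^+ h.
Proof.
move=> A0 D2 HD nN.
have -> : J R A h n = conv (fun k => (ncount A k)%:R / k.+1%:R) h n.
  rewrite -sum_compositions; apply: eq_bigr => k _; apply: eq_bigr => i _.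
  by rewrite counting_funE.
apply: (@conv_le R _ _ N) => [k|||| k kN].
- by rewrite divr_ge0.
- by rewrite !mulr_ge0.
- by [].
- exact: sum_density_le.
- apply: le_trans (_ : (ncount A k)%:R <= _).
    rewrite mulrCA ler_piMr // ler_pdivrMr ?ltr0n // mul1r ler_nat; lia.
  have : (ncount A k)%:R <= (ncount A N)%:R :> R by rewrite ler_nat leq_ncount.
  have : 2 <= D%:R :> R by rewrite ler_nat.
  by have := ler0n R (ncount A N); nra.
Qed.

(** * Truncation by moments, and sums of representation counts *)

Lemma powR_truncate (R : realType) (s M eps : R) : 0 <= s -> 0 < M -> 0 < eps ->
  s <= M + s `^ (1 + eps) / M `^ eps.
Proof.
move=> s0 M0 eps0; case: (leP s M) => [sM|Ms].
  by rewrite (le_trans sM) // lerDl divr_ge0 // powR_ge0.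
have s_gt0 : 0 < s := lt_trans M0 Ms.
apply: le_trans (_ : s `^ (1 + eps) / M `^ eps <= _); last by rewrite lerDr ltW.
rewrite ler_pdivlMr ?powR_gt0 // powRD; last by rewrite (gt_eqF s_gt0) implybT.
rewrite powRr1 // ler_wpM2l // ge0_ler_powR ?nnegrE ?ltW //.
Qed.

(** Turns a lower bound for a weighted sum over [S] into one for the number of its elements: weights
    up to M cost M each, and the moment pays for the larger ones. *)
Lemma sum_truncate (R : realType) (S : pred nat) (f : nat -> R) (M eps : R)
  (n : nat) : (forall k, 0 <= f k) -> 0 < M -> 0 < eps ->
  \sum_(1 <= k < n.+1) (S k)%:R * f k <=
    M * (pcount S n)%:R + (\sum_(k < n.+1) f k `^ (1 + eps)) / M `^ eps.
Proof.
move=> f0 M0 eps0.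
rewrite -(big_mkord xpredT (fun k => f k `^ (1 + eps))) /pcount natr_sum.
apply: le_trans (_ : \sum_(1 <= k < n.+1) (M * (S k)%:R
    + f k `^ (1 + eps) / M `^ eps) <= _).
  apply: ler_sum => k _; case: (S k); last first.
    by rewrite mul0r mulr0 add0r divr_ge0 // powR_ge0.
  by rewrite mul1r mulr1 powR_truncate.
rewrite big_split /= -mulr_sumr -mulr_suml lerD2l ler_wpM2r ?invr_ge0 ?powR_ge0 //.
by rewrite [leRHS]big_ltn // lerDr powR_ge0.
Qed.

Lemma repr_count_subset (A B : set nat) (h n : nat) : B `<=` A ->
  (repr_count B h n <= repr_count A h n)%N.
Proof.
move=> BA; apply/subset_leq_card/fintype.subsetP => k.
rewrite !inE => /andP[-> /forallP kB] /=; apply/forallP => i.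
by apply/mem_set/BA/set_mem.
Qed.

Lemma sum_repr_count_le (R : realType) (A : set nat) (h m : nat) :
  \sum_(0 <= n < m.+1) (repr_count A h n)%:R <= (ncount A m)%:R ^+ h :> R.
Proof.
under eq_bigr do rewrite repr_countE.
rewrite /ncount natr_sum; exact: sum_conv_le.
Qed.

Lemma sum_repr_count_ge (R : realType) (A : set nat) (h m : nat) :
  (ncount A m)%:R ^+ h <= \sum_(0 <= n < (h * m).+1) (repr_count A h n)%:R :> R.
Proof.
under eq_bigr do rewrite repr_countE.
rewrite /ncount natr_sum; exact: sum_conv_ge.
Qed.

(** * Positive density of hB and the conclusion *)

Lemma pcount_linear (R : realType) (S : pred nat) (h x0 : nat) (c : R) :
  (1 <= h)%N -> S 1%N -> 0 < c ->
  (forall x, (x0 <= x)%N -> c * x%:R <= (pcount S (h * x))%:R) ->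
  exists2 tau : R, 0 < tau & forall n, tau * n%:R <= (pcount S n)%:R.
Proof.
move=> h1 S1 c0 Hc; pose T := (h * x0.+1).+1.
have T0 : 0 < T%:R :> R by rewrite ltr0n.
have h0 : 0 < h%:R :> R by rewrite ltr0n.
(* The first value serves n >= T, where x = n / h >= 1 gives n < h (x + 1) <= 2hx; the second serves
   0 < n < T, where 1 in [S] makes the count at least 1. *)
exists (Num.min (c / (2 * h%:R)) T%:R^-1) => [|n].
  by rewrite lt_min invr_gt0 T0 divr_gt0 // mulr_gt0.
case: (leqP T n) => [Tn|nT].
  apply: le_trans (_ : c / (2 * h%:R) * n%:R <= _).
    by rewrite ler_wpM2r // ge_min lexx.
  pose x := (n %/ h)%N.
  have xx : (x0.+1 <= x)%N by rewrite leq_divRL // mulnC; rewrite /T in Tn; lia.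
  apply: le_trans (_ : c * x%:R <= _).
    rewrite -mulrA ler_pM2l // mulrC ler_pdivrMr ?mulr_gt0 //.
    rewrite -!natrM ler_nat.
    have := ltn_ceil n h1; rewrite -/x; nia.
  apply: le_trans (Hc _ (ltnW xx)) _; rewrite ler_nat.
  by rewrite (@pcount_cat S (h * x) n) ?leq_addr // mulnC leq_trunc_div.
case: (posnP n) => [->|n0]; first by rewrite mulr0.
apply: le_trans (_ : T%:R^-1 * n%:R <= _).
  by rewrite ler_wpM2r // ge_min lexx orbT.
apply: le_trans (_ : 1 <= _); first by rewrite mulrC ler_pdivrMr // mul1r ler_nat ltnW.
by rewrite ler1n (pcount_cat _ n0) /pcount big_nat1 S1.
Qed.

(** The comparison of B with A enters only through c, so that B = A and its subsequences are treated
    together. *)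
Lemma subset_additive_basis (R : realType) (A B : set nat) (h : nat)
    (SS E : nat -> R) (eps c : R) :
  (1 <= h)%N -> OR_plus R A -> B `<=` A -> [set 0%N; 1%N] `<=` B ->
  (forall n, 0 <= SS n) ->
  (forall n, (repr_count A h n)%:R = SS n * J R A h n + E n) ->
  (E : nat -> R^o) =o_\oo (fun n => (repr_count A h n)%:R : R^o) ->
  0 < eps ->
  (fun x : R => x^-1 * \sum_(n < (Num.truncn x).+1) SS n `^ (1 + eps) : R^o)
    =O_+oo (fun=> 1 : R^o) ->
  0 < c -> (forall n, c * (ncount A n)%:R <= (ncount B n)%:R) ->
  additive_basis B.
Proof.
move=> h1 [A2 [a aA a2]] BA B01 SS0 r_eq Eo eps0 SSavg c0 cAB.
have A0 : A 0%N by apply/BA/B01; left.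
have B0 : B 0%N by apply: B01; left.
have B1 : B 1%N by apply: B01; right.
have [D D2 HD] := ncount_growth (subset_trans B01 BA) aA a2.
have [C C1 HC] := ncount_dilate h A0 A2.
have [n1 Hn1] : exists n1 : nat, forall n, (n1 <= n)%N ->
    (repr_count A h n)%:R <= 2 * (SS n * J R A h n).
  have half0 : 0 < 1 / 2 :> R by lra.
  move: Eo => /eqoP /(_ _ half0) [n1 _ Hn1]; exists n1 => n /Hn1.
  rewrite normr_nat => En.
  by have := ler_norm (E n); have := r_eq n; lra.
have [C' C'0 [N HN]] := eqO_pinfty_nat SSavg.
(* The strict inequality forces n > 0, so that the factor 1/n can be cleared. *)
have {}HN n : (N < n)%N -> \sum_(k < n.+1) SS k `^ (1 + eps) <= C' * n%:R.
  move=> Nn; have n0 : 0 < n%:R :> R by rewrite ltr0n; lia.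
  have := HN n (ltnW Nn); rewrite (natrK n) normr1 mulr1 => /(le_trans (ler_norm _)).
  by rewrite mulrC ler_pdivrMr.
have [t Ht] : exists t, (2 / 3) ^+ t <= c ^+ h / 2 :> R.
  have : (2 / 3 : R) ^+ n @[n --> \oo] --> (0 : R).
    by apply: cvg_expr; rewrite ger0_norm; lra.
  have ch0 : 0 < c ^+ h / 2 by rewrite divr_gt0 // exprn_gt0.
  move=> /cvgrPdist_le /(_ _ ch0) [t _ /(_ t (leqnn t))] /=.
  by rewrite sub0r normrN => /(le_trans (ler_norm _)); exists t.
have D1 : (1 <= D)%N := ltnW D2.
have Dt0 : (0 < D ^ t)%N by rewrite expn_gt0 D1.
have DtR : 0 < (D ^ t)%:R :> R by rewrite ltr0n.
have hR : 0 < h%:R :> R by rewrite ltr0n.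
pose S : pred nat := mem (sumset h B).
(* Q is the constant in n J(n) <= Q A(x)^h for n <= hx, where C replaces A(hx) by A(x). *)
have [Q Q0 QE] : exists2 Q : R, 0 < Q & Q = h%:R * (3 * D%:R * C) ^+ h.
  eexists; last by [].
  by rewrite mulr_gt0 // exprn_gt0 // !mulr_gt0 ?ltr0n //; lra.
(* Obtained by solving c^h A(x)^h / 2 <= 2 Q A(x)^h D^t X / x for X / x, with X the sum of [SS] over
   S up to hx. *)
pose c2 : R := c ^+ h / (4 * Q * (D ^ t)%:R).
have c20 : 0 < c2 by rewrite divr_gt0 ?exprn_gt0 // mulr_gt0 // mulr_gt0.
pose x0 := (D ^ t * (n1 + N).+1)%N.
have sumS x : (x0 <= x)%N ->
    c2 * x%:R <= \sum_(1 <= k < (h * x).+1) (S k)%:R * SS k.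
  move=> x0x; pose m := (x %/ D ^ t)%N.
  have mbig : (n1 + N < m)%N by rewrite leq_divRL // mulnC.
  have m1 : (1 <= m)%N := leq_ltn_trans (leq0n _) mbig.
  have mx : (D ^ t * m <= x)%N by rewrite mulnC leq_trunc_div.
  have xm : (x < D ^ t * m.+1)%N by rewrite mulnC ltn_ceil.
  have mlex : (m <= h * x)%N.
    by apply: leq_trans (leq_trans mx _); rewrite leq_pmull.
  have xR : 0 < x%:R :> R.
    by rewrite ltr0n (leq_trans _ x0x) // muln_gt0 Dt0.
  set X := \sum_(1 <= k < _) _.
  have Ax0 : 0 < (ncount A x)%:R :> R by rewrite ltr0n ncount_gt0.
  set a_x : R := (ncount A x)%:R ^+ h.
  have ax0 : 0 < a_x by rewrite exprn_gt0.
  have low : c ^+ h * a_x <=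
      \sum_(0 <= n < (h * x).+1) (repr_count B h n)%:R.
    apply: le_trans (sum_repr_count_ge _ _ _ _).
    by rewrite -exprMn lerXn2r ?nnegrE // mulr_ge0 // ltW.
  (* t was chosen so that the n <= x / D^t contribute at most half of
     the lower bound. *)
  have head : \sum_(0 <= n < m.+1) (repr_count B h n)%:R <= c ^+ h / 2 * a_x.
    apply: le_trans (_ : (2 / 3) ^+ t * a_x <= _); last by rewrite ler_wpM2r // ltW.
    apply: le_trans (_ : (ncount A m)%:R ^+ h <= _).
      apply: le_trans (_ : \sum_(0 <= n < m.+1) (repr_count A h n)%:R <= _).
        by apply: ler_sum => n _; rewrite ler_nat repr_count_subset.
      exact: sum_repr_count_le.
    apply: le_trans (_ : ((2 / 3) ^+ t * (ncount A x)%:R) ^+ h <= _).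
      apply: lerXn2r; rewrite ?nnegrE ?mulr_ge0 ?exprn_ge0 //.
      apply: le_trans (ncount_growth_iter R D1 HD t m1) _.
      by rewrite ler_wpM2l ?exprn_ge0 // ler_nat leq_ncount.
    rewrite exprMn -/a_x ler_pM2r // -exprM; apply: ler_wiXn2l; first by lra.
      by lra.
    by rewrite leq_pmulr.
  have tail : \sum_(m.+1 <= n < (h * x).+1) (repr_count B h n)%:R <=
      2 * Q * a_x * (D ^ t)%:R / x%:R * X.
    have coef_ge0 : 0 <= 2 * Q * a_x * (D ^ t)%:R / x%:R.
      by rewrite ltW // divr_gt0 // !mulr_gt0.
    rewrite /X [in leRHS](big_cat_nat (n := m.+1)) //= mulrDr ler_wpDl //.
      by rewrite mulr_ge0 ?sumr_ge0 // => n _; rewrite mulr_ge0.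
    rewrite mulr_sumr; apply: ler_sum_nat => n /andP[mn nhx].
    (* Only n in S contribute; for these r_B <= r_A <= 2 [SS] J, as n > m > n1. *)
    have [->|rB] := eqVneq (repr_count B h n) 0%N.
      by apply: mulr_ge0; [exact: coef_ge0 | rewrite mulr_ge0].
    rewrite (_ : S n); last exact/mem_set/repr_count_sumset.
    rewrite mul1r; apply: le_trans (_ : (repr_count A h n)%:R <= _).
      by rewrite ler_nat repr_count_subset.
    have n1n : (n1 <= n)%N.
      exact: leq_trans (leq_addr N n1) (ltnW (ltn_trans mbig mn)).
    apply: le_trans (Hn1 n n1n) _.
    have nJ : n%:R * J R A h n <= Q * a_x.
      apply: le_trans (@J_le R A D h n (h * x) A0 D2 HD nhx) _.
      rewrite QE -[leRHS]mulrA ler_wpM2l // /a_x -exprMn.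
      have D3 : 0 <= 3 * D%:R :> R by rewrite mulr_ge0.
      apply: lerXn2r; rewrite ?nnegrE.
      - exact: mulr_ge0.
      - by rewrite mulr_ge0 // mulr_ge0 // (le_trans ler01).
      - by rewrite -[leRHS]mulrA ler_wpM2l.
    suff : J R A h n <= Q * a_x * (D ^ t)%:R / x%:R.
      move=> J_le_n; have -> : 2 * Q * a_x * (D ^ t)%:R / x%:R * SS n =
          2 * (SS n * (Q * a_x * (D ^ t)%:R / x%:R)) by ring.
      by rewrite ler_wpM2l // ler_wpM2l.
    rewrite ler_pdivlMr //.
    (* Beyond m = x / D^t, the factor 1/n in the bound for J is at most D^t / x. *)
    have xn : x%:R <= n%:R * (D ^ t)%:R :> R.
      rewrite -natrM ler_nat; apply: leq_trans (ltnW xm) _.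
      by rewrite mulnC leq_mul2r mn orbT.
    have [J0|/ltW J0] := leP 0 (J R A h n).
      by have := ler_wpM2r J0 xn; have := ler_wpM2r (ltW DtR) nJ; lra.
    apply: le_trans (_ : 0 <= _); first by rewrite mulr_le0_ge0 // ltW.
    by rewrite !mulr_ge0 // ltW.
  rewrite (big_cat_nat (n := m.+1)) //= in low.
  have : c ^+ h * a_x <= c ^+ h / 2 * a_x + 2 * Q * a_x * (D ^ t)%:R / x%:R * X.
    by apply: le_trans low _; apply: lerD.
  have -> : 2 * Q * a_x * (D ^ t)%:R / x%:R * X =
      2 * Q * (D ^ t)%:R * X / x%:R * a_x by ring.
  rewrite -mulrDl ler_pM2r // -lerBlDl ler_pdivlMr // => main_le.
  rewrite /c2 [leLHS]mulrAC ler_pdivrMr ?mulr_gt0 //; lra.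
(* M makes the truncation error h C' x / M^eps equal to c2 x / 2. *)
pose M := (2 * h%:R * C' / c2) `^ eps^-1.
have HM0 : 0 < 2 * h%:R * C' / c2 by rewrite divr_gt0 // !mulr_gt0.
have M0 : 0 < M by rewrite powR_gt0.
have ME : M `^ eps = 2 * h%:R * C' / c2.
  by rewrite -powRrM mulVf ?gt_eqF // powRr1 // ltW.
(* Truncation gives c2 x <= M |S| + c2 x / 2, with S counted up to hx, hence the constant c2 /
   (2M). *)
have [||||tau tau0 Htau] := @pcount_linear R S h (x0 + N).+1 (c2 / (2 * M)).
- by [].
- by apply/mem_set/sumset_mem.
- by rewrite divr_gt0 // mulr_gt0.
- move=> x xbig; have x0x : (x0 <= x)%N := leq_trans (leq_addr _ _) (ltnW xbig).
  have Nhx : (N < h * x)%N.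
    by apply: leq_ltn_trans (leq_addl x0 N) (leq_trans xbig _); rewrite leq_pmull.
  have := le_trans (sumS x x0x) (sum_truncate S (h * x) SS0 M0 eps0).
  have : (\sum_(k < (h * x).+1) SS k `^ (1 + eps)) / M `^ eps <= c2 / 2 * x%:R.
    rewrite ler_pdivrMr ?powR_gt0 // ME; apply: le_trans (HN _ Nhx) _.
    have -> : c2 / 2 * x%:R * (2 * h%:R * C' / c2) = C' * (h%:R * x%:R).
      by field; rewrite gt_eqF.
    by rewrite natrM.
  move=> trunc_le sum_le; rewrite mulrAC ler_pdivrMr ?mulr_gt0 //; lra.
- exact: additive_basis_density h1 B0 tau0 Htau.
Qed.

Theorem theoremA10 (R : realType) (A : set nat)
    (A_infinite : infinite_set A)
    (A_OR : OR_plus R A)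
    (A_01 : [set 0%N; 1%N] `<=` A)
    (h : nat) (h_ge1 : (1 <= h)%N)
    (SS E : nat -> R)
    (SS_ge0 : forall n, 0 <= SS n)
    (r_eq : forall n, (repr_count A h n)%:R = SS n * J R A h n + E n)
    (E_small : (E : nat -> R^o) =o_\oo (fun n => (repr_count A h n)%:R : R^o))
    (eps : R) (eps_gt0 : 0 < eps)
    (SS_avg : (fun x : R =>
                x^-1 * \sum_(n < (Num.truncn x).+1) SS n `^ (1 + eps) : R^o)
             =O_+oo (fun=> 1 : R^o)) :
  stable_basis R A.
Proof.
split=> [|B _ BA B01 AB].
  apply: (@subset_additive_basis R A A h SS E eps 1) => // n.
  by rewrite mul1r.
have [c c0 cAB] := @ncount_Theta R A B (B01 0%N (or_introl erefl)) AB.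
exact: (@subset_additive_basis R A B h SS E eps c).
Qed.
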